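(* Let $n=2^{r+1}p_1\cdots p_k$, where $r\ge 0$, $k\ge 1$ and $p_1,\ldots,p_k$ are (not necessarily distinct) odd primes. Let $a_0,\ldots,a_{r-1}$ be odd integers, let $c$ be an integer divisible by $2^{r+1}$, and let $b_1,\ldots,b_k$ be integers such that $b_i$ is odd and coprime to $p_i$ for each $1\le i\le k$. If $k\ge 2$, let $S$ be the sequence in $\mathbb{Z}_n$ $$(a_0,\ 2a_1,\ \ldots,\ 2^{r-1}a_{r-1},\ c,\ 2^rb_1,\ 2^rp_1b_2,\ \ldots,\ 2^rp_1\cdots p_{k-1}b_k,\ \underbrace{n/2,\ldots,n/2}_{n-1\text{ times}}),$$ and if $k=1$, let $S$ be the sequence $$(a_0,\ 2a_1,\ \ldots,\ 2^{r-1}a_{r-1},\ c,\ 2^r,\ \underbrace{n/2,\ldots,n/2}_{n-1\text{ times}})$$ (when $r=0$ there are no terms $2^ia_i$). Then $S$ is a $U(n)$-extremal sequence for the Gao constant.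
   Context: $\mathbb{Z}_n=\mathbb{Z}/n\mathbb{Z}$ and $U(n)$ is its group of units; integers are identified with their images in $\mathbb{Z}_n$. A sequence is a finite list $(x_1,\ldots,x_l)$ of elements of $\mathbb{Z}_n$ (repetitions allowed); a subsequence is obtained by restricting to a subset of the indices. For $A\subseteq\mathbb{Z}_n$, a subsequence of $(x_1,\ldots,x_l)$ with index set $I$ is an $A$-weighted zero-sum subsequence if $I\ne\emptyset$ and there exist $a_i\in A$ ($i\in I$) with $\sum_{i\in I}a_ix_i=0$. The $A$-weighted Gao constant $E_A(n)$ is the least positive integer $k$ such that every sequence of length $k$ in $\mathbb{Z}_n$ has an $A$-weighted zero-sum subsequence of length $n$. An $A$-extremal sequence for the Gao constant is a sequence in $\mathbb{Z}_n$ of length $E_A(n)-1$ which has no $A$-weighted zero-sum subsequence of length $n$. *)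

(* Defs.v *)
From HB Require Import structures.
From mathcomp Require Import all_boot all_order all_algebra.
Set Implicit Arguments.
Unset Strict Implicit.
Unset Printing Implicit Defensive.
Import GRing.Theory.
Local Open Scope ring_scope.

(* Z/nZ is rendered by 'Z_n, which is the ring of integers mod n only when
   1 < n; the definitions below are meant for such n. *)

Definition U (n : nat) : {set 'Z_n} := [set x : 'Z_n | x \is a GRing.unit].

(* I is a set of positions of s, so repeated terms are kept apart and the
   length of the corresponding subsequence is #|I|. *)
Definition weighted_zero_sum (n : nat) (A : {set 'Z_n}) (s : seq 'Z_n)
    (I : {set 'I_(size s)}) : Prop :=
  I != set0 /\
  exists a : 'I_(size s) -> 'Z_n,
    (forall i, i \in I -> a i \in A) /\ \sum_(i in I) a i * s`_i = 0.

Definition has_weighted_zero_sum_of_length (n : nat) (A : {set 'Z_n})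
    (s : seq 'Z_n) (m : nat) : Prop :=
  exists I : {set 'I_(size s)}, weighted_zero_sum A I /\ #|I| = m.

Definition gao_property (n : nat) (A : {set 'Z_n}) (l : nat) : Prop :=
  forall s : seq 'Z_n, size s = l -> has_weighted_zero_sum_of_length A s n.

(* E = E_A(n).  The constant is given by its graph because, for arbitrary A,
   no integer need have the Gao property (e.g. A empty). *)
Definition is_gao_constant (n : nat) (A : {set 'Z_n}) (E : nat) : Prop :=
  [/\ (0 < E)%N, gao_property A E &
      forall l : nat, (0 < l)%N -> gao_property A l -> (E <= l)%N].

Definition gao_extremal (n : nat) (A : {set 'Z_n}) (s : seq 'Z_n) : Prop :=
  exists E : nat,
    [/\ is_gao_constant A E, size s = E.-1 &
        ~ has_weighted_zero_sum_of_length A s n].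

(* (2^r b_1, 2^r p_1 b_2, ..., 2^r p_1 ... p_(k-1) b_k), with indices of p and
   b shifted to start at 0. *)
Definition middle_terms (r k : nat) (p : 'I_k -> nat) (b : 'I_k -> int) :
    seq int :=
  [seq (2 ^ r * \prod_(j < k | (j < i)%N) p j)%N%:Z * b i | i : 'I_k].

(* (a_0, 2 a_1, ..., 2^(r-1) a_(r-1), c, mid, n/2, ..., n/2) reduced mod n, with
   n-1 copies of n/2. *)
Definition candidate (n r : nat) (a : 'I_r -> int) (c : int) (mid : seq int) :
    seq 'Z_n :=
  [seq z%:~R | z <- [seq (2 ^ i)%N%:Z * a i | i : 'I_r] ++ c :: mid
                      ++ nseq n.-1 (n %/ 2)%N%:Z].

(* Main.v *)
Require Import Defs.
From HB Require Import structures.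
From mathcomp Require Import all_boot all_order all_algebra.
From mathcomp Require Import zify.
Set Implicit Arguments.
Unset Strict Implicit.
Unset Printing Implicit Defensive.
Import GRing.Theory.
Local Open Scope ring_scope.

(* The Gao constant of U(n) is n + Omega(n). The terms of S other than the n - 1
   copies of n/2 are ordered by valuation: modulo a suitable divisor of n the
   first one that is selected is isolated, and c is excluded because, modulo
   2^(r+1), every selected term would be 2^r except c, while n is even; so fewer
   than n terms remain.

   Conversely, a set of terms has a weighted zero sum as soon as, for each prime
   power q^e exactly dividing n, those terms of least q-adic valuation (when it is
   below e) number at least two if q is odd, and an even number if q = 2. Among
   the n + Omega(n) terms take a minimal set J with |J| >= n + (the sum over q of
   the deficits e - v_q(J)). In J the terms of least 2-adic valuation and the
   others form two classes; if the smaller one is odd, a set K meeting it in an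
   odd number of terms and costing only one more than it gains is removed. The
   excess is then trimmed from the larger class, sparing two terms per odd prime. *)

(** * Set combinatorics: blocks, trimming, balanced subsets *)

Section Blocks.
Variable T : finType.
Implicit Types (X Y K I P : {set T}).
Local Open Scope nat_scope.

(** The union [cl y] of all members of [F] through [y] is again in [F], so it is the largest such
    member. The traces of these unions partition [Y]; as [#|Y|] is odd, one trace is odd. *)
Lemma odd_maximal_block (F : pred {set T}) Y :
    {in Y, forall y, F [set y]} ->
    (forall K1 K2, F K1 -> F K2 -> ~~ [disjoint K1 & K2] -> F (K1 :|: K2)) ->
    odd #|Y| ->
  exists K, [/\ F K, odd #|K :&: Y| &
                forall K', F K' -> K \subset K' -> K' \subset K].
Proof.
move=> F1 FU oddY; pose cl y := \bigcup_(K | F K && (y \in K)) K.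
have clS y K : F K -> y \in K -> K \subset cl y.
  by move=> FK yK; apply: (bigcup_max K) => //; rewrite FK.
have clF y : y \in Y -> F (cl y) /\ y \in cl y.
  move=> yY; have ycl: y \in cl y.
    by apply: (subsetP (clS y [set y] _ _)); rewrite ?F1 ?set11.
  have: cl y = set0 \/ F (cl y) /\ y \in cl y.
    rewrite /cl; apply: (big_ind (fun K => K = set0 \/ F K /\ y \in K)).
    - by left.
    - move=> K1 K2 [-> | [F1' y1]] [-> | [F2 y2]]; rewrite ?set0U ?setU0.
      + by left.
      + by right.
      + by right.
      right; split; last by rewrite inE y1.
      by apply: FU => //; apply/pred0Pn; exists y; rewrite /= y1.
    - by move=> K /andP[FK yK]; right.
  by case=> [E|//]; rewrite E inE in ycl.
have cl_eq y z : y \in Y -> z \in Y -> (cl z == cl y) = (z \in cl y).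
  move=> yY zY; apply/eqP/idP => [<-|zcl]; first by case: (clF z zY).
  have [Fy yy] := clF y yY; have [Fz zz] := clF z zY.
  have yz := clS _ _ Fy zcl.
  by apply/eqP; rewrite eqEsubset yz clS ?(subsetP yz).
have [/existsP[y /andP[yY oddy]] | noodd] :=
    boolP [exists y, (y \in Y) && odd #|cl y :&: Y|].
  have [Fy yy] := clF y yY; exists (cl y); split=> // K' FK' /subsetP sK.
  exact/clS/sK.
case/negP: noodd; apply: contraLR oddY => noodd.
rewrite -sum1_card (partition_big_imset cl) /=.
apply: (big_ind (fun k => ~~ odd k)) => // [a b|C /imsetP[y yY ->]].
  by rewrite oddD => /negPf-> /negPf->.
have -> : \sum_(i in Y | cl i == cl y) 1 = #|cl y :&: Y|.
  rewrite -sum1_card; apply: eq_bigl => z; rewrite inE andbC.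
  by case: (boolP (z \in Y)) => [zY|]; rewrite ?andbF // cl_eq.
by apply: contra noodd => oddy; apply/existsP; exists y; rewrite yY.
Qed.

(** Elements of [X :\: P] are discarded one at a time; the last hypothesis says that there are
    enough of them to get down to [m]. *)
Lemma trim_between P X I m :
    P \subset I -> m <= #|I| -> #|I :\: (X :\: P)| <= m ->
  exists I', [/\ I' \subset I, P \subset I', #|I'| = m & I' :\: X = I :\: X].
Proof.
move=> PI; move Dj: (#|I| - m) => j.
elim: j I PI Dj => [|j IHj] I PI Dj mI Im.
  by exists I; split=> //; apply/eqP; rewrite eqn_leq mI andbT -subn_eq0 Dj.
have /subsetPn[x xI xD] : ~~ (I \subset I :\: (X :\: P)).
  by apply/negP => /subset_leq_card; lia.
have {xD} /andP[xP xX] : (x \notin P) && (x \in X).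
  by move: xD; rewrite !inE xI andbT negbK.
have cI := cardsD1 x I; rewrite xI /= in cI.
have [|||| I' [sI PI' cI' eI']] := IHj (I :\ x).
- by rewrite subsetD1 PI.
- by lia.
- by lia.
- apply: leq_trans Im; apply/subset_leq_card/subsetP => z.
  by rewrite !inE => /and3P[-> _ ->].
exists I'; split=> //; first by apply: subset_trans sI (subsetDl _ _).
rewrite eI'; apply/setP => z; rewrite !inE.
by case: (eqVneq z x) => [->|]; rewrite ?xX.
Qed.

(** * Functions whose maxima must be attained twice, or evenly often *)

Section Deficits.
Variables (ps : seq nat) (delta : nat -> T -> nat).

Definition top (f : T -> nat) X := \max_(x in X) f x.

(** Amounts to saying that the maximum of [f] on [X], if positive, is attained at least twice. *)
Definition balanced (f : T -> nat) X :=
  [forall y in X, (0 < f y) ==> [exists z in X, (z != y) && (f y <= f z)]].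

Lemma balancedP f X :
  reflect (forall y, y \in X -> 0 < f y ->
             exists z, [/\ z \in X, z != y & f y <= f z])
          (balanced f X).
Proof.
apply: (iffP forall_inP) => bal y yX; last first.
  apply/implyP=> y0; have [z [zX zy le]] := bal y yX y0.
  by apply/exists_inP; exists z; rewrite ?zy.
by move/(implyP (bal y yX))/exists_inP => [z zX /andP[zy le]]; exists z.
Qed.

Definition topsum X := \sum_(q <- ps) top (delta q) X.

Lemma leq_top f X x : x \in X -> f x <= top f X.
Proof. exact: leq_bigmax_cond. Qed.

Lemma topS f X Y : X \subset Y -> top f X <= top f Y.
Proof. by move/subsetP=> sXY; apply/bigmax_leqP => x /sXY; apply: leq_top. Qed.

Lemma topU f X Y : top f (X :|: Y) <= maxn (top f X) (top f Y).
Proof.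
apply/bigmax_leqP => x; rewrite inE leq_max.
by case/orP=> /(leq_top f) ->; rewrite ?orbT.
Qed.

Lemma topD1_lt f X y : y \in X -> 0 < f y ->
  (forall z, z \in X -> z != y -> f z < f y) -> top f (X :\ y) < top f X.
Proof.
move=> yX fy lt; apply: leq_trans (leq_top f yX); rewrite -(prednK fy) ltnS.
by apply/bigmax_leqP => z; rewrite !inE => /andP[zy zX]; move: (lt z zX zy); lia.
Qed.

Lemma topP f X : 0 < top f X ->
  exists y, [/\ y \in X, 0 < f y & forall z, z \in X -> f z <= f y].
Proof.
move=> X0; have: 0 < #|X|.
  rewrite card_gt0; apply: contraL X0 => /eqP->.
  by rewrite /top big_set0.
case/(eq_bigmax_cond f) => y yX E; exists y.
rewrite /top in X0 *; rewrite E in X0; split=> // z zX.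
by rewrite -E; apply: leq_top.
Qed.

Lemma topsumS X Y : X \subset Y -> topsum X <= topsum Y.
Proof. by move=> sXY; apply: leq_sum => q _; apply: topS. Qed.

(** Makes [#|X| - topsum X] supermodular. For each [q] the maximum over the union is the larger of
    the two maxima, and that over the intersection is at most the smaller. *)
Lemma topsum_supermodular X Y : topsum (X :|: Y) + topsum (X :&: Y) <= topsum X + topsum Y.
Proof.
rewrite /topsum -!big_split; apply: leq_sum => q _ /=.
have := topU (delta q) X Y; have := topS (delta q) (subsetIl X Y).
by have := topS (delta q) (subsetIr X Y); lia.
Qed.

(** Imbalance means that a single element carries the positive maximum for [q]; deleting it lowers
    that maximum and raises no other. *)
Lemma unbalanced_drop X q : q \in ps -> ~~ balanced (delta q) X ->
  exists2 y, y \in X & topsum (X :\ y) < topsum X.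
Proof.
move=> qps; rewrite negb_forall_in => /exists_inP[y yX].
rewrite negb_imply negb_exists_in => /andP[y0 /forall_inP lt]; exists y => //.
have lt' : top (delta q) (X :\ y) < top (delta q) X.
  apply: topD1_lt => // z zX zy; have := lt z zX.
  by rewrite zy /= -ltnNge.
rewrite /topsum (perm_big _ (perm_to_rem qps)) /=.
rewrite [X in _ < X](perm_big _ (perm_to_rem qps)) /= !big_cons -addSn leq_add //.
by apply: leq_sum => r _; apply/topS/subsetDl.
Qed.

(** Two elements with the largest [delta q] are kept for each [q]; inside [X] they remain the
    largest. *)
Lemma balanced_witness X : {in ps, forall q, balanced (delta q) X} ->
  exists P, [/\ P \subset X, #|P| <= 2 * size ps &
    forall I, P \subset I -> I \subset X -> {in ps, forall q, balanced (delta q) I}].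
Proof.
elim: ps => [|q qs IH] bal; first by exists set0; rewrite sub0set cards0.
case: IH => [r rqs|P [PX cP balP]]; first by apply: bal; rewrite inE rqs orbT.
have [/topP[y [yX y0 ymax]] | ] := ltnP 0 (top (delta q) X).
  have /balancedP/(_ y yX y0)[z [zX zy le]] := bal q (mem_head _ _).
  exists (P :|: [set y; z]); split.
  - by rewrite !subUset PX !sub1set yX zX.
  - rewrite (leq_trans (leq_card_setU _ _)) //= cards2.
    by case: (_ != _); lia.
  move=> I; rewrite subUset => /andP[PI]; rewrite subUset !sub1set => /andP[yI zI] IX.
  move=> r; rewrite inE => /orP[/eqP->|]; last exact: balP.
  apply/balancedP => w wI w0; case: (eqVneq w y) => [->|wy]; first by exists z.
  by exists y; rewrite yI eq_sym wy; split=> //; apply: ymax; apply: (subsetP IX).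
rewrite leqn0 => /eqP q0; exists P; split=> //=; first by lia.
move=> I PI IX r; rewrite inE => /orP[/eqP->|]; last exact: balP.
apply/balancedP => w wI w0; have := leq_top (delta q) (subsetP IX w wI); lia.
Qed.

(* The sets [K] whose removal costs at most one more than it gains in [topsum]
   are closed under union of intersecting pairs; a maximal one meeting [Y] in an
   odd number of points is removed. *)
Lemma even_balanced_subset c (J Y : {set T}) : Y \subset J ->
    c.+1 + topsum J <= #|J| ->
    (forall X, X \proper J -> #|X| <= c + topsum X) ->
  exists X, [/\ X \subset J, c + ~~ odd #|Y| + topsum X <= #|X|,
    ~~ odd #|X :&: Y| & {in ps, forall q, balanced (delta q) X}].
Proof.
move=> YJ cJ Jmin; have cardD1J (X : {set T}) y : y \in X -> #|X| = #|X :\ y|.+1.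
  by move=> yX; rewrite (cardsD1 y X) yX.
have [oddY|evenY] := boolP (odd #|Y|); last first.
  exists J; rewrite (setIidPr YJ) addn1; split=> // q qps.
  apply: contraT => /(unbalanced_drop qps)[y yJ lt].
  by have := Jmin _ (properD1 yJ); have := cardD1J _ _ yJ; lia.
pose F (K : {set T}) :=
  [&& K \subset J, K != set0 & c + topsum (J :\: K) <= #|J :\: K|].
have [||K [/and3P[KJ K0 cK] oddK maxK]] := @odd_maximal_block F Y _ _ oddY.
- move=> y /(subsetP YJ) yJ; rewrite /F sub1set yJ -card_gt0 cards1 /=.
  by have := cardD1J _ _ yJ; have := topsumS (subsetDl J [set y]); lia.
- move=> K1 K2 /and3P[K1J K10 cK1] /and3P[K2J K20 cK2] /pred0Pn[x /= xK].
  rewrite /F subUset K1J K2J setU_eq0 negb_and K10 setDUr /=.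
  have := topsum_supermodular (J :\: K1) (J :\: K2).
  have := cardsUI (J :\: K1) (J :\: K2); rewrite -setDIr.
  (* This set is proper, so minimality bounds its size from above; supermodularity then bounds
     [J :\: (K1 :|: K2)] from below. *)
  have /Jmin : J :\: (K1 :&: K2) \proper J.
    rewrite properE subsetDl; apply/subsetPn; exists x; rewrite ?inE ?xK //.
    by case/andP: xK => /(subsetP K1J).
  lia.
exists (J :\: K); rewrite subsetDl addn0; split=> // [|q qps].
  have := oddY; rewrite -(cardsID K Y) oddD setIC oddK /=.
  by rewrite setIDAC (setIidPr YJ).
(* If [J :\: K] were unbalanced, dropping [y] would preserve the size bound, and [y |: K] would
   contradict the maximality of [K]. *)
apply: contraT => /(unbalanced_drop qps)[y]; rewrite inE => /andP[yK yJ] lt.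
have eK : (J :\: K) :\ y = J :\: (y |: K) by rewrite setUC -setDDl.
have yJK : y \in J :\: K by rewrite inE yK.
have /maxK : F (y |: K).
  rewrite /F subUset sub1set yJ KJ -card_gt0 cardsU1 yK /= -eK.
  by have := cardD1J _ _ yJK; lia.
by move/(_ (subsetUr _ _))/subsetP/(_ y (setU11 _ _)); rewrite (negPf yK).
Qed.

Definition even_top (f : T -> nat) X :=
  (forall x, x \in X -> f x = 0) \/
  exists y, [/\ y \in X, 0 < f y, forall z, z \in X -> f z <= f y &
                ~~ odd #|[set z in X | f z == f y]|].

(** Here [gamma] stands for the 2-adic deficit and [delta] for those at the odd primes. Passing to a
    minimal [J] makes the size bound tight. *)
Lemma balanced_subset (gamma : T -> nat) (J : {set T}) m :
    ~~ odd m -> 0 < size ps -> top gamma J + topsum J + 4 * size ps <= m ->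
    m + top gamma J + topsum J <= #|J| ->
  exists I, [/\ #|I| = m, even_top gamma I &
                {in ps, forall q, balanced (delta q) I}].
Proof.
move=> evm ps0 bound; rewrite -addnA => mJ.
pose big (X : {set T}) := m + (top gamma X + topsum X) <= #|X|.
have [J' /minsetP[bigJ minJ] sJ] := minset_exists (mJ : big J).
have {}bound : top gamma J' + topsum J' + 4 * size ps <= m.
  by have := topS gamma sJ; have := topsumS sJ; lia.
move: J' sJ bigJ minJ bound => {J mJ} J _ mJ minJ bound.
have small (X : {set T}) : X \proper J -> #|X| < m + (top gamma X + topsum X).
  move=> XJ; rewrite ltnNge; apply/negP => /minJ/(_ (proper_sub XJ)) E.
  by rewrite E properxx in XJ.
(* One less than [m + top gamma J], to pay for an odd class: if [top gamma J] is positive, [c] is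
   still at least [m]. *)
have [c cE] : exists c, c.+1 = m + top gamma J by exists (m + top gamma J).-1; lia.
have cJ : #|J| <= c.+1 + topsum J.
  have /card_gt0P[y yJ] : 0 < #|J| by rewrite /big in mJ; lia.
  have := small _ (properD1 yJ); rewrite (cardsD1 y J) yJ /=.
  by have := topS gamma (subsetDl J [set y]); have := topsumS (subsetDl J [set y]); lia.
have Jmin (X : {set T}) : X \proper J -> #|X| <= c + topsum X.
  by move=> XJ; have := small X XJ; have := topS gamma (proper_sub XJ); lia.
(* Parity is settled on the smaller class [Y], and trimming takes place only outside [Y], so the
   parity survives. *)
have step (Y : {set T}) : Y \subset J -> (odd #|Y| -> 0 < top gamma J) ->
    2 * #|Y| <= #|J| ->
  exists X I, [/\ X \subset J, I \subset X, c + topsum X <= #|X| & #|I| = m] /\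
    [/\ ~~ odd #|I :&: Y|, I :&: Y = X :&: Y & {in ps, forall q, balanced (delta q) I}].
  move=> YJ oddY Ysmall.
  have [|X [XJ cX evX balX]] := even_balanced_subset YJ _ Jmin.
    by rewrite /big in mJ; lia.
  have [P [PX cP balP]] := balanced_witness balX.
  have [||I [IX PI cI eI]] := @trim_between P (~: Y) X m PX.
  - by move: oddY cX; case: (odd _) => // [/(_ isT)|_]; lia.
  (* What trimming cannot touch has at most [#|J| / 2 + 2 * size ps] elements; the term
     [4 * size ps] in [bound] makes this at most [m]. *)
  - have sub : X :\: (~: Y :\: P) \subset Y :|: P.
      by apply/subsetP => z; rewrite !inE negb_and !negbK orbC => /andP[].
    have := subset_leq_card sub; have := (leq_card_setU Y P).1; lia.
  rewrite !setDE setCK in eI.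
  exists X, I; split; split=> //; rewrite ?eI //; first by lia.
  exact: balP.
have [g0|gpos] := posnP (top gamma J).
  have [|||X [I [[XJ IX _ cI] [_ _ bI]]]] := step set0; rewrite ?sub0set ?cards0 //.
  exists I; split=> //; left=> x xI.
  by have := leq_top gamma (subsetP XJ _ (subsetP IX _ xI)); lia.
have [y [yJ y0 ymax]] := topP gpos.
have topy : top gamma J = gamma y.
  by apply/eqP; rewrite eqn_leq leq_top // andbT; apply/bigmax_leqP.
pose A := [set z in J | gamma z == gamma y].
have AJ : A \subset J by apply/subsetP => z; rewrite inE => /andP[].
have cA := cardsID A J; rewrite (setIidPr AJ) in cA.
have finish I : I \subset J -> I :&: A != set0 -> ~~ odd #|I :&: A| -> even_top gamma I.
  move=> IJ /set0Pn[x]; rewrite !inE => /and3P[xI xJ /eqP xy] ev.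
  right; exists x; rewrite xy; split=> // [z /(subsetP IJ)/ymax //|].
  suff -> : [set z in I | gamma z == gamma y] = I :&: A by [].
  by apply/setP => z; rewrite !inE; case zI: (z \in I) => //=; rewrite (subsetP IJ).
have [le|gt] := leqP #|A| #|J :\: A|.
  have [|||X [I [[XJ IX cX cI] [ev eX bI]]]] := step A; rewrite ?AJ //; first by lia.
  exists I; split=> //; apply: finish => //; first exact: subset_trans XJ.
  (* If [X] missed [A], its [gamma]-maximum would fall below that of [J], and [small] would
     contradict the lower bound [cX]. *)
  rewrite eX; apply/negP => /eqP XA0.
  have yX : y \notin X.
    by apply/negP => yX; move/setP/(_ y): XA0; rewrite !inE yX yJ eqxx.
  have XpJ : X \proper J by rewrite properE XJ; apply/subsetPn; exists y.
  have : top gamma X < gamma y.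
    rewrite -(prednK y0) ltnS; apply/bigmax_leqP => z zX.
    have := ymax z (subsetP XJ z zX); move/setP/(_ z): XA0.
    by rewrite !inE zX (subsetP XJ) //=; case: eqP => //; lia.
  by have := small X XpJ; lia.
have [|||X [I [[XJ IX cX cI] [ev eX bI]]]] := step (J :\: A); rewrite ?subsetDl //; first by lia.
have IJ := subset_trans IX XJ.
have eI : I :&: (J :\: A) = I :\: A.
  by rewrite setIDA (setIidPl IJ).
have cIA := cardsID A I.
(* Fewer than [m] elements lie outside [A], so [I] meets [A]; as [m] is even, evenness outside [A]
   passes to [A]. *)
exists I; split=> //; apply: finish => //.
  rewrite -card_gt0 lt0n; apply/eqP => IA0.
  have := subset_leq_card (setSD A IJ); lia.
by move: evm; rewrite -cI -cIA oddD -eI (negPf ev) addbF.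
Qed.

End Deficits.
End Blocks.

(** * Unit weights: solutions at each prime power, glued modulo [n] *)

Section Weights.
Local Open Scope nat_scope.

(* How far the [q]-adic valuation of [x], truncated at that of [n], falls short
   of that of [n]; in this form [x = 0] causes no exception. *)
Definition deficit n q x := logn q (n %/ gcdn n x).

Lemma deficit_le n q x : deficit n q x <= logn q n.
Proof. by rewrite /deficit logn_div ?dvdn_gcdl // leq_subr. Qed.

Lemma dvdn_deficit n q x j : 0 < n -> prime q -> j <= logn q n ->
  (q ^ j %| x) = (j + deficit n q x <= logn q n).
Proof.
move=> n0 pq le; rewrite /deficit logn_div ?dvdn_gcdl //.
have g0 : 0 < gcdn n x by rewrite gcdn_gt0 n0.
have lg : logn q (gcdn n x) <= logn q n by rewrite dvdn_leq_log ?dvdn_gcdl.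
have -> : (j + (logn q n - logn q (gcdn n x)) <= logn q n) = (j <= logn q (gcdn n x)) by lia.
by rewrite -pfactor_dvdn // dvdn_gcd (pfactor_dvdn _ pq n0) le.
Qed.

(** [y] is invertible modulo [q ^ m], so [w = -t / y] works; it is coprime to [q] because [t] is. *)
Lemma dvdn_complete q m y t : prime q -> coprime y q -> coprime t q ->
  exists2 w, coprime w q & q ^ m %| w * y + t.
Proof.
move=> pq cy ct; case: m => [|m]; first by exists 1; rewrite ?coprime1n ?dvd1n.
set M := q ^ m.+1; have M0 : 0 < M by rewrite expn_gt0 prime_gt0.
have [u _] := Bezoutl y M0.
rewrite (eqP (coprimeXl m.+1 _)) 1?coprime_sym // => uy.
exists (u * t); last by rewrite mulnAC addnC -mulSn dvdn_mulr.
rewrite coprimeMl ct andbT coprime_sym prime_coprime //.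
apply: contraL uy => qu; apply: contraL (prime_gt1 pq) => Md.
have : q %| 1 + u * y by apply: dvdn_trans Md; rewrite dvdn_exp.
by rewrite dvdn_addl ?dvdn_mulr // dvdn1 => /eqP->.
Qed.

Section LocalWeights.
Variables (T : finType) (n q : nat) (x : T -> nat).
Hypotheses (n_gt0 : 0 < n) (prime_q : prime q).
Implicit Types (I : {set T}) (w : T -> nat).
Let e := logn q n.
Let d z := deficit n q (x z).

Lemma dvdn_pow j z : j <= e -> (q ^ j %| x z) = (j + d z <= e).
Proof. exact: dvdn_deficit. Qed.

Lemma d_le z : d z <= e.
Proof. exact: deficit_le. Qed.

Definition local_weights I w :=
  (forall z, coprime (w z) q) /\ q ^ e %| \sum_(z in I) w z * x z.

Lemma local_weights_trivial I :
  (forall z, z \in I -> d z = 0) -> local_weights I (fun=> 1).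
Proof.
move=> d0; split=> [z|]; first exact: coprime1n.
apply: dvdn_sum => z /d0 dz.
by rewrite mul1n dvdn_pow // dz addn0.
Qed.

Lemma quotient_coprime i : 0 < d i -> coprime (x i %/ q ^ (e - d i)) q.
Proof.
move=> di; have le := d_le i.
rewrite coprime_sym prime_coprime // dvdn_divRL.
  by rewrite -expnS dvdn_pow; lia.
by rewrite dvdn_pow; lia.
Qed.

Lemma dvdn_quotient i z : d z < d i -> q %| x z %/ q ^ (e - d i).
Proof.
move=> lt; have le := d_le i.
rewrite dvdn_divRL; last by rewrite dvdn_pow; lia.
by rewrite -expnS dvdn_pow; lia.
Qed.

(** [q ^ (e - d i)] divides every term in [I]. After division the term at [i] is a unit modulo [q],
    and its weight is solved for; it is a unit because the rest sums to one. *)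
Lemma local_weights_complete I i w :
    i \in I -> 0 < d i -> (forall z, z \in I -> d z <= d i) ->
    (forall z, coprime (w z) q) ->
    coprime (\sum_(z in I | z != i) w z * (x z %/ q ^ (e - d i))) q ->
  exists w', local_weights I w'.
Proof.
move=> iI di dmax cw ct; have le := d_le i.
have [u cu ud] := dvdn_complete (d i) prime_q (quotient_coprime di) ct.
pose w' z := if z == i then u else w z.
exists w'; split=> [z|]; first by rewrite /w'; case: ifP.
rewrite [in q ^ e](_ : e = (d i) + (e - d i)); last by lia.
have -> : \sum_(z in I) w' z * x z =
    (\sum_(z in I) w' z * (x z %/ q ^ (e - d i))) * q ^ (e - d i).
  rewrite big_distrl; apply: eq_bigr => z zI /=.
  rewrite -mulnA divnK // dvdn_pow; last by lia.
  by have := dmax z zI; lia.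
rewrite expnD dvdn_pmul2r ?expn_gt0 ?prime_gt0 //.
rewrite (bigD1 i) //= /w' eqxx.
rewrite (eq_bigr (fun z => w z * (x z %/ q ^ (e - d i)))) //.
by move=> z /andP[_ /negPf->].
Qed.

(** Of two terms of largest deficit, [j] is weighted so that the sum without [i] is coprime to [q],
    and [i] completes it. *)
Lemma local_weights_odd I : odd q -> balanced d I -> exists w, local_weights I w.
Proof.
move=> oq /balancedP bal.
have [d0|dpos] := posnP (top d I).
  exists (fun=> 1); apply: local_weights_trivial => z zI.
  by have := leq_top d zI; lia.
have [i [iI di dmax]] := topP dpos.
have [j [jI ji le]] := bal i iI di.
have dj : d j = d i by apply/eqP; rewrite eqn_leq le dmax.
pose y z := x z %/ q ^ (e - d i).
have cyj : coprime (y j) q by rewrite /y -dj quotient_coprime // dj.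
pose t := \sum_(z in I | (z != i) && (z != j)) y z.
(* As q is odd, 1 and 2 are distinct units mod q, and one of them works. *)
have [u cu ct] : exists2 u, coprime u q & coprime (u * y j + t) q.
  have [c1|] := boolP (coprime (1 * y j + t) q); first by exists 1; rewrite ?coprime1n.
  rewrite coprime_sym prime_coprime // negbK mul1n => qd; exists 2.
    by rewrite coprime2n.
  rewrite coprime_sym prime_coprime // mul2n -addnn -addnA dvdn_addl //.
  by rewrite -prime_coprime // coprime_sym.
pose w z := if z == j then u else 1.
apply: (@local_weights_complete I i w) => //.
  by move=> z; rewrite /w; case: ifP; rewrite ?coprime1n.
rewrite (bigD1 j) ?jI //= /w eqxx.
rewrite (eq_bigr y) => [|z /andP[_ /negPf->]]; last by rewrite mul1n.
by under eq_bigl => z do rewrite -andbA.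
Qed.

(** With weights 1 and the common power divided out, exactly the terms of largest deficit are odd.
    Their number is even, so without [i] the sum is odd, and [i] completes it. *)
Lemma local_weights_two I : q = 2 -> even_top d I -> exists w, local_weights I w.
Proof.
move=> q2 [d0 | [i [iI di dmax ev]]].
  by exists (fun=> 1); apply: local_weights_trivial.
apply: (@local_weights_complete I i (fun=> 1)) => // [z|].
  exact: coprime1n.
pose y z := x z %/ q ^ (e - d i).
have oddy z : z \in I -> odd (y z) = (d z == d i).
  move=> zI; have := dmax z zI; rewrite leq_eqVlt.
  case/predU1P => [E|lt].
    have := @quotient_coprime z; rewrite E eqxx -/(y z) => /(_ di).
    by rewrite [X in coprime _ X]q2 coprimen2.
  by have := dvdn_quotient lt; rewrite q2 dvdn2 -q2 -/(y z) => /negPf->; rewrite ltn_eqF.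
rewrite q2 coprimen2 -q2.
have parity (P : pred T) : {subset P <= I} ->
   odd (\sum_(z | P z) 1 * y z) = odd (\sum_(z | P z) (d z == d i)).
  move=> PI; apply: (big_ind2 (fun a b => odd a = odd b)) => // [a b a' b' E E'|z Pz].
    by rewrite !oddD E E'.
  by rewrite mul1n oddy ?oddb //; apply: PI.
rewrite (parity (fun z => (z \in I) && (z != i))); last by move=> z /andP[].
move: ev; rewrite -sum1_card (bigD1 i) /=; last by rewrite inE iI eqxx.
rewrite oddD negbK /is_true => <-; congr (odd _).
rewrite [LHS]big_mkcond [RHS]big_mkcond; apply: eq_bigr => z _; rewrite inE.
by case: (z \in I); case: (z == i); case: (d z == d i).
Qed.

Lemma local_weights_mod I w w' : 0 < e ->
  (forall z, w' z = w z %[mod q ^ e]) -> local_weights I w -> local_weights I w'.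
Proof.
move=> e0 ww [cw dw]; split=> [z|].
  have qe : q %| q ^ e by rewrite dvdn_exp.
  by rewrite -coprime_modl -(modn_dvdm _ qe) ww modn_dvdm // coprime_modl.
rewrite /dvdn -modn_summ in dw; rewrite /dvdn -modn_summ.
by under eq_bigr => z _ do rewrite -modnMml ww modnMml.
Qed.
End LocalWeights.

(** Chinese remainder theorem: only the residues modulo each [q ^ logn q n] matter. *)
Lemma local_weights_glue (T : finType) n (x : T -> nat) I (ps : seq nat) :
    uniq ps -> all prime ps -> {in ps, forall q, 0 < logn q n} ->
    {in ps, forall q, exists w, local_weights n q x I w} ->
  exists w, {in ps, forall q, local_weights n q x I w}.
Proof.
elim: ps => [|q ps IH] /=; first by exists (fun=> 0).
case/andP=> qps ups /andP[pq pps] e0 loc.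
have [||w wP] := IH ups pps.
- by move=> r rps; apply: e0; rewrite inE rps orbT.
- by move=> r rps; apply: loc; rewrite inE rps orbT.
have [u uP] := loc q (mem_head _ _).
have co : coprime (q ^ logn q n) (\prod_(r <- ps) r ^ logn r n).
  elim: (ps) qps pps => [|r rs IHrs]; rewrite ?big_nil ?coprimen1 //=.
  rewrite inE negb_or big_cons => /andP[qr qrs] /andP[pr prs].
  by rewrite coprimeMr IHrs // andbT coprimeXl ?coprimeXr // prime_coprime // dvdn_prime2.
exists (fun z => chinese (q ^ logn q n) (\prod_(r <- ps) r ^ logn r n) (u z) (w z)).
move=> r; rewrite inE => /predU1P[->|rps].
  by apply: local_weights_mod uP => [|z]; rewrite ?e0 ?mem_head // chinese_modl.
apply: local_weights_mod (wP r rps) => [|z]; first by rewrite e0 // inE rps orbT.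
have dv : r ^ logn r n %| \prod_(r <- ps) r ^ logn r n.
  by rewrite (perm_big _ (perm_to_rem rps)) big_cons dvdn_mulr.
by rewrite -(modn_dvdm _ dv) chinese_modr // modn_dvdm.
Qed.

Lemma global_weights (T : finType) n (x : T -> nat) (I : {set T}) : 0 < n ->
    {in primes n, forall q, exists w, local_weights n q x I w} ->
  exists w, (forall z, coprime (w z) n) /\ n %| \sum_(z in I) w z * x z.
Proof.
move=> n0 /local_weights_glue[||q|w wP]; first exact: primes_uniq.
- by apply/allP=> q; rewrite mem_primes => /andP[].
- by rewrite logn_gt0.
exists w; split=> [z|].
  rewrite coprime_sym; apply: contraT => nco.
  have g1 : 1 < gcdn n (w z).
    by have : 0 < gcdn n (w z) by [rewrite gcdn_gt0 n0]; rewrite /coprime in nco; lia.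
  have [pq qg] := (pdiv_prime g1, pdiv_dvd (gcdn n (w z))).
  have [|/(_ z) + _] := wP (pdiv (gcdn n (w z))).
    by rewrite mem_primes pq n0 (dvdn_trans qg (dvdn_gcdl _ _)).
  by rewrite coprime_sym prime_coprime // (dvdn_trans qg (dvdn_gcdr _ _)).
apply/dvdn_partP => // q qn; rewrite p_part.
by case: (wP q _).
Qed.

End Weights.

(** * Upper bound n + Omega(n) for the Gao constant *)

Section UpperBound.
Local Open Scope nat_scope.

Lemma logn_prod (I : finType) (p : I -> nat) q : (forall i, 0 < p i) ->
  logn q (\prod_i p i) = \sum_i logn q (p i).
Proof.
move=> p0; apply: (proj2 (A := 0 < \prod_i p i)).
apply: (big_ind2 (fun a b => 0 < a /\ logn q a = b)) => //; first by rewrite logn1.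
by move=> a b a' b' [a0 <-] [b0 <-]; rewrite muln_gt0 a0 b0 lognM.
Qed.

Lemma sum_logn_primes (I : finType) (p : I -> nat) : (forall i, prime (p i)) ->
  \sum_(q <- primes (\prod_i p i)) logn q (\prod_i p i) <= #|I|.
Proof.
move=> pp; rewrite (eq_bigr (fun q => \sum_i logn q (p i))); last first.
  by move=> q _; apply: logn_prod => i; apply: prime_gt0.
rewrite exchange_big -sum1_card; apply: leq_sum => i _ /=.
set M := \prod_i _; rewrite big_seq (eq_bigr (fun q => (q == p i) : nat)); last first.
  by move=> q; rewrite mem_primes => /andP[pq _]; rewrite logn_prime.
rewrite -big_seq -big_mkcond /= sum1_count.
by rewrite count_uniq_mem ?primes_uniq // leq_b1.
Qed.

Lemma weighted_zero_sum_units n (s : seq 'Z_n) (I : {set 'I_(size s)}) (w : 'I_(size s) -> nat) :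
    1 < n -> I != set0 -> (forall z, coprime (w z) n) ->
    n %| \sum_(z in I) w z * (s`_z)%R ->
  weighted_zero_sum (U n) I.
Proof.
move=> n1 I0 cw dv; split=> //; exists (fun z => (w z)%:R)%R; split=> [z _|].
  by rewrite inE unitZpE // coprime_sym.
have -> : (\sum_(z in I) (w z)%:R * s`_z = (\sum_(z in I) w z * (s`_z)%R)%N%:R)%R.
  by rewrite natr_sum; apply: eq_bigr => z _; rewrite natrM natr_Zp.
by case/dvdnP: dv => m ->; rewrite natrM pchar_Zp // mulr0.
Qed.

Section Factored.
Variables (n r k : nat) (p : 'I_k -> nat).
Hypothesis k_gt0 : 0 < k.
Hypothesis odd_prime : forall i, prime (p i) /\ odd (p i).
Hypothesis n_def : n = 2 ^ r.+1 * \prod_(i < k) p i.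
Let M := \prod_(i < k) p i.

Lemma prod_odd_primes_gt0 : 0 < M.
Proof. by apply: prodn_gt0 => i; case: (odd_prime i) => /prime_gt0. Qed.

Lemma odd_prod_odd_primes : odd M.
Proof.
apply: (big_ind (fun m => odd m)) => // [a b|i _]; first by rewrite oddM => ->.
by case: (odd_prime i).
Qed.

(** The room that [balanced_subset] requires for [m = n]: the maxima total at most [r.+1 + k], and
    at most [k] distinct odd primes occur. *)
Lemma omega_bound : r.+1 + k + 4 * k <= n.
Proof.
have M3 : 3 ^ k <= M.
  rewrite -[X in _ ^ X]card_ord -prod_nat_const; apply: leq_prod => i _.
  by case: (odd_prime i) => /prime_gt1; case: (p i) => [|[|[]]].
have {}M3 : 3 * k <= M.
  by apply: leq_trans M3; elim: (k) => // -[//|j];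
     rewrite !expnS; move: (3 ^ j) => t; lia.
have r2 : 2 * r.+1 <= 2 ^ r.+1.
  by elim: (r) => // j; rewrite (expnS _ j.+1); move: (2 ^ j.+1) => t; lia.
by rewrite n_def; apply: leq_trans (leq_mul r2 M3); nia.
Qed.

Lemma units_gao_property : gao_property (U n) (n + (r.+1 + k)).
Proof.
move=> s sz; pose x (z : 'I_(size s)) : nat := (s`_z)%R.
have nb := omega_bound; have M0 := prod_odd_primes_gt0.
have two0 : 0 < 2 ^ r.+1 by rewrite expn_gt0.
have odd_primes q : q \in primes M -> prime q /\ odd q.
  rewrite mem_primes => /and3P[pq _ qM]; split=> //.
  exact: dvdn_odd qM odd_prod_odd_primes.
have logM q : q \in primes M -> logn q n = logn q M.
  case/odd_primes => pq oq; rewrite n_def lognM // (@logn_coprime _ (2 ^ _)) //.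
  by rewrite coprimeXr // coprimen2.
have log2 : logn 2 n = r.+1.
  by rewrite n_def lognM // pfactorK // (@logn_coprime _ (\prod_i _)) ?addn0 //
    coprime2n odd_prod_odd_primes.
have topb : top (fun z => deficit n 2 (x z)) [set: 'I_(size s)] <= r.+1.
  by apply/bigmax_leqP => z _; rewrite -log2 deficit_le.
have logk : \sum_(q <- primes M) logn q M <= k.
  by have := @sum_logn_primes _ p (fun i => (odd_prime i).1); rewrite card_ord.
have totb : topsum (primes M) (fun q z => deficit n q (x z)) [set: 'I_(size s)] <= k.
  apply: leq_trans logk; rewrite /topsum !big_seq; apply: leq_sum => q qM.
  by apply/bigmax_leqP => z _; rewrite -logM ?deficit_le.
have sizeb : size (primes M) <= k.
  rewrite (leq_trans _ logk) // -sum1_size !big_seq; apply: leq_sum => q.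
  by rewrite logn_gt0.
have size0 : 0 < size (primes M).
  case: (odd_prime (Ordinal k_gt0)) => pi _.
  rewrite -has_predT; apply/hasP; exists (p (Ordinal k_gt0)) => //.
  by rewrite mem_primes pi M0 /M (bigD1 (Ordinal k_gt0)) //= dvdn_mulr.
have evn : ~~ odd n by rewrite n_def expnS -mulnA mul2n odd_double.
(* The deficits total at most [r.+1 + k], which is the excess of the length over [n]. *)
have [||I [cI even bal]] := @balanced_subset _ (primes M) (fun q z => deficit n q (x z))
   (fun z => deficit n 2 (x z)) setT n evn size0.
- by apply: leq_trans nb; apply: leq_add (leq_add topb totb) _; rewrite leq_mul2l.
- by rewrite cardsT card_ord [leqRHS]sz -addnA leq_add2l; apply: leq_add topb totb.
have n0 : 0 < n by lia.
have [q|w [cw dw]] := @global_weights _ n x I n0.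
  rewrite {1}n_def primesM // primesX // primes_prime // => /orP[|qM].
    rewrite inE => /eqP->; exact: local_weights_two.
  have [pq oq] := odd_primes q qM; apply: local_weights_odd => //; exact: bal.
exists I; split=> //; apply: weighted_zero_sum_units cw dw; first by lia.
by rewrite -card_gt0 cI.
Qed.
End Factored.
End UpperBound.

(** * Prefixes, and a criterion for extremality *)

Lemma has_weighted_zero_sum_take n (A : {set 'Z_n}) (s : seq 'Z_n) l m : (l <= size s)%N ->
  has_weighted_zero_sum_of_length A (take l s) m -> has_weighted_zero_sum_of_length A s m.
Proof.
move=> ls [I [[I0 [a [aA sum0]]] cI]].
have le : (size (take l s) <= size s)%N by rewrite size_take_min geq_minr.
pose f := widen_ord le; have inj_f : injective f by move=> i j /(congr1 val) /= /val_inj.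
(* The default 0 is used only at positions beyond the prefix. *)
pose a' j := if [pick i | f i == j] is Some i then a i else 0.
have a'f i : a' (f i) = a i.
  by rewrite /a'; case: pickP => [j /eqP/inj_f-> //|/(_ i)]; rewrite eqxx.
exists (f @: I); rewrite card_imset //; split=> //; split; first by rewrite imset_eq0.
exists a'; split=> [j /imsetP[i iI ->]|]; first by rewrite a'f aA.
rewrite big_imset /=; last by move=> i j _ _; apply: inj_f.
rewrite -[RHS]sum0; apply: eq_bigr => i _; rewrite a'f nth_take //.
by apply: leq_trans (ltn_ord i) _; rewrite size_take_min geq_minl.
Qed.

(** The sequence itself gives the lower bound: if some [l <= size s] had the Gao property, the
    prefix of length [l] would contain a weighted zero sum of length [n]. *)
Lemma gao_extremal_of n (A : {set 'Z_n}) (s : seq 'Z_n) :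
    gao_property A (size s).+1 -> ~ has_weighted_zero_sum_of_length A s n ->
  gao_extremal A s.
Proof.
move=> gao no; exists (size s).+1; split=> //; split=> // l _ gaol.
rewrite ltnNge; apply/negP => ls; apply: no.
by apply: (has_weighted_zero_sum_take ls); apply: gaol; rewrite size_takel.
Qed.

(** * Divisibility of integers, sums and products *)

Lemma dvdz_intr_eq0 n (z : int) : (1 < n)%N -> z%:~R = 0 :> 'Z_n -> (n %| z)%Z.
Proof.
move=> n1 z0; rewrite dvdzE /=.
have : `|z|%N%:R = 0 :> 'Z_n.
  by case: z z0 => m //=; rewrite NegzE mulrNz => /eqP; rewrite oppr_eq0 => /eqP.
by rewrite Zp_nat => /(congr1 val) /=; rewrite Zp_cast // => /eqP.
Qed.

Lemma dvdz_bigsum (I : finType) (P : pred I) (F : I -> int) (d : int) :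
  (forall i, P i -> (d %| F i)%Z) -> (d %| \sum_(i | P i) F i)%Z.
Proof.
move=> dF; apply: (big_ind (fun s => (d %| s)%Z)) => //.
by move=> s t; apply: rpredD.
Qed.

Lemma dvdn_prod_sub (I : finType) (P Q : pred I) (F : I -> nat) : subpred P Q ->
  (\prod_(i | P i) F i %| \prod_(i | Q i) F i)%N.
Proof.
move=> PQ; rewrite [X in (_ %| X)%N](bigID P) /=.
rewrite (eq_bigl P) ?dvdn_mulr // => i.
by case: (boolP (P i)) => [/PQ->|]; rewrite ?andbF.
Qed.

Lemma dvd2z_mul_odd (x y : int) : ~~ (2 %| x)%Z -> ~~ (2 %| y)%Z -> ~~ (2 %| x * y)%Z.
Proof. by rewrite !dvdzE abszM !dvdn2 !negbK oddM => -> ->. Qed.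

(** * The sequence S has no weighted zero sum of length [n] *)

Section Candidate.
Variables (n r k : nat) (p : 'I_k -> nat).
Hypothesis odd_prime : forall i, prime (p i) /\ odd (p i).
Hypothesis n_def : n = (2 ^ r.+1 * \prod_(i < k) p i)%N.
Variables (a : 'I_r -> int) (c : int) (b : 'I_k -> int).
Hypothesis odd_a : forall i, ~~ (2 %| a i)%Z.
Hypothesis dvd_c : ((2 ^ r.+1)%N%:Z %| c)%Z.
Hypothesis odd_coprime_b : forall i, ~~ (2 %| b i)%Z /\ coprimez (b i) (p i)%:Z.

Let M := (\prod_(i < k) p i)%N.
Let L := [seq (2 ^ i)%N%:Z * a i | i : 'I_r] ++ c :: middle_terms r p b
           ++ nseq n.-1 (n %/ 2)%N%:Z.

Lemma size_candidate_terms : size L = (r.+1 + k + n.-1)%N.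
Proof. by rewrite size_cat /= size_cat size_nseq !size_image !card_ord; lia. Qed.

Lemma nth_a_terms (i : 'I_r) : L`_i = (2 ^ i)%N%:Z * a i.
Proof.
rewrite nth_cat size_image card_ord ltn_ord (nth_map i) ?size_enum_ord //.
by rewrite nth_ord_enum.
Qed.

Lemma nth_c_term : L`_r = c.
Proof. by rewrite nth_cat size_image card_ord ltnn subnn. Qed.

Lemma nth_middle_terms (i : 'I_k) :
  L`_(r.+1 + i) = (2 ^ r * \prod_(j < k | (j < i)%N) p j)%N%:Z * b i.
Proof.
rewrite nth_cat size_image card_ord ltnNge addSnnS leq_addr /= addKn /=.
rewrite nth_cat size_image card_ord ltn_ord (nth_map i) ?size_enum_ord //.
by rewrite nth_ord_enum.
Qed.

Lemma nth_half_terms j : (r.+1 + k <= j < size L)%N -> L`_j = (2 ^ r * M)%N.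
Proof.
rewrite size_candidate_terms => /andP[le lt].
rewrite nth_cat size_image card_ord ifF; last by lia.
have -> : (j - r = (j - r.+1).+1)%N by lia.
rewrite /= nth_cat size_image card_ord ifF; last by lia.
rewrite nth_nseq ifT; last by lia.
by rewrite n_def expnS -mulnA mulKn.
Qed.

Lemma position_cases j : (r < j < size L)%N ->
  (exists i : 'I_k, j = (r.+1 + i)%N) \/ (r.+1 + k <= j < size L)%N.
Proof.
case/andP=> rj ->; have [le|lt] := leqP (r.+1 + k) j; [by right | left].
have ik : (j - r.+1 < k)%N by lia.
by exists (Ordinal ik) => /=; lia.
Qed.

Lemma pow2_dvd_nth e j : (j < size L)%N -> (e <= j)%N -> (e <= r)%N ->
  ((2 ^ e)%N%:Z %| L`_j)%Z.
Proof.
move=> jL ej er; have [jr|rj|jr] := ltngtP j r.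
- by rewrite (nth_a_terms (Ordinal jr)) dvdz_mulr // dvdzE /= dvdn_exp2l.
- have [|[i ->]|half] := @position_cases j; first by rewrite rj.
    by rewrite nth_middle_terms dvdz_mulr // dvdzE /= dvdn_mulr // dvdn_exp2l.
  by rewrite nth_half_terms // dvdzE /= dvdn_mulr // dvdn_exp2l.
by rewrite jr nth_c_term (dvdz_trans _ dvd_c) // dvdzE /= dvdn_exp2l // leqW.
Qed.

(** Serves to exclude [c]: an odd multiple of [2 ^ r] is congruent to [2 ^ r] modulo [2 ^ r.+1]. *)
Lemma nth_odd_cofactor j : (r < j < size L)%N ->
  exists2 o : int, L`_j = (2 ^ r)%N%:Z * o & ~~ (2 %| o)%Z.
Proof.
have oddp (P : pred 'I_k) : ~~ (2 %| (\prod_(i | P i) p i)%N%:Z)%Z.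
  rewrite dvdzE dvdn2 negbK; apply: (big_ind (fun m => odd m)) => // [x y|i _].
    by rewrite /= oddM => ->.
  by case: (odd_prime i).
case/position_cases=> [[i ->]|half].
  rewrite nth_middle_terms PoszM -mulrA; eexists; first by [].
  by apply: dvd2z_mul_odd => //; case: (odd_coprime_b i).
by exists (M : int); [rewrite nth_half_terms // PoszM | apply: (oddp xpredT)].
Qed.

Lemma candidate_zero_sum_free :
  (1 < n)%N -> ~ has_weighted_zero_sum_of_length (U n) (candidate n a c (middle_terms r p b)) n.
Proof.
move=> n1 [I [[I0 [u [uU sum0]]] cI]].
have sizeE : size (candidate n a c (middle_terms r p b)) = size L by rewrite size_map.
have zL (z : 'I_(size (candidate n a c (middle_terms r p b)))) : (z < size L)%N.
  by rewrite -sizeE.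
pose w z : int := (u z : nat)%:Z.
have nsum : (n %| \sum_(z in I) w z * L`_z)%Z.
  apply: dvdz_intr_eq0 => //; rewrite rmorph_sum -[RHS]sum0 /=.
  apply: eq_bigr => z _; rewrite rmorphM /= (nth_map 0) ?zL //.
  by rewrite /w -pmulrn natr_Zp.
have cw z : z \in I -> coprimez n (w z).
  by move=> /uU; rewrite inE -{1}[u z]natr_Zp unitZpE // coprimezE.
(* The weight at [z] is a unit modulo [n], hence modulo [D], and can be cancelled. *)
have isolated D z : (D %| n)%N -> z \in I ->
    (forall z', z' \in I -> z' != z -> (D %| L`_z')%Z) -> (D %| L`_z)%Z.
  move=> Dn zI other.
  have Dsum : (D %| \sum_(z in I) w z * L`_z)%Z by apply: dvdz_trans nsum; rewrite dvdzE.
  have rest : (D %| \sum_(j in I | j != z) w j * L`_j)%Z.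
    by apply: dvdz_bigsum => z' /andP[z'I z'z]; rewrite dvdz_mull ?other.
  have := rpredB Dsum rest; rewrite (bigD1 z) //= addrK.
  by rewrite Gauss_dvdzr //; apply: coprimez_dvdl (cw z zI).
have two_n : (2 ^ r.+1 %| n)%N by rewrite n_def dvdn_mulr.
have two_n' : (2 %| n)%N by rewrite n_def expnS -mulnA dvdn_mulr.
(* At the first selected position [z < r], the divisor [2 ^ z.+1] kills all later terms but not
   [2 ^ z * a z]. *)
have noa z : z \in I -> (r <= z)%N.
  have [m] := ubnP (nat_of_ord z); elim: m z => // m IHm z zm zI.
  rewrite leqNgt; apply/negP => zr.
  have : ((2 ^ z.+1)%N %| L`_z)%Z.
    apply: isolated => //; first by apply: dvdn_trans two_n; rewrite dvdn_exp2l // ltnW.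
    move=> z' z'I ne; apply: pow2_dvd_nth => //.
    rewrite ltnNge leq_eqVlt negb_or (inj_eq val_inj) ne /= -leqNgt leqNgt.
    apply/negP => lt; have := IHm z' _ z'I; lia.
  rewrite (nth_a_terms (Ordinal zr)) /= expnSr PoszM dvdz_mul2l; last by rewrite eqz_nat expn_eq0.
  by rewrite (negPf (odd_a _)).
have noc z : z \in I -> (r < z)%N.
  move=> zI; rewrite ltn_neqAle noa // andbT; apply/eqP => zr.
  (* The [n - 1] selected terms other than [c] are each [2 ^ r] modulo [2 ^ r.+1] after weighting,
     so [n - 1] would be even. *)
  have dif : ((2 ^ r.+1)%N %| \sum_(j in I | j != z) (w j * L`_j - (2 ^ r)%N%:Z))%Z.
    apply: dvdz_bigsum => j /andP[jI jz].
    have rj : (r < j < size L)%N.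
      rewrite zL ltn_neqAle noa // !andbT; apply: contraNneq jz => rj.
      exact/eqP/val_inj/(etrans (esym rj) zr).
    have [o -> oddo] := nth_odd_cofactor rj.
    rewrite mulrCA -[X in _ - X]mulr1 -mulrBr expnSr PoszM dvdz_mul2l; last first.
      by rewrite eqz_nat expn_eq0.
    have oddw : ~~ (2 %| w j)%Z.
      have := coprimez_dvdl two_n' (cw j jI).
      by rewrite coprimezE coprime2n dvdzE dvdn2 negbK.
    have := dvd2z_mul_odd oddw oddo; lia.
  have Dsum : ((2 ^ r.+1)%N %| \sum_(j in I) w j * L`_j)%Z.
    by apply: dvdz_trans nsum; rewrite dvdzE.
  have Dc : ((2 ^ r.+1)%N %| w z * L`_z)%Z by rewrite -zr nth_c_term dvdz_mull.
  have := rpredB (rpredB Dsum Dc) dif.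
  rewrite (bigD1 z) //= [w z * _ + _]addrC addrK sumrB opprB addrC subrK.
  rewrite (eq_bigl (fun j => j \in I :\ z)) => [|j]; last by rewrite !inE andbC.
  have cIz : #|I :\ z| = n.-1.
    by have := cardsD1 z I; rewrite zI cI => E; apply: esym (congr1 predn E).
  rewrite sumr_const cIz -mulr_natr natz -PoszM dvdzE /= expnSr.
  rewrite dvdn_pmul2l ?expn_gt0 // => two_pred.
  have : (2 %| n - n.-1)%N by rewrite dvdn_sub.
  by have -> : (n - n.-1 = 1)%N by lia.
(* At the first selected middle term [i], the divisor is the product of the [p j] with [j <= i]: it
   divides all later terms, but [p i] divides neither [2 ^ r] nor [b i]. *)
have nob z : z \in I -> (r.+1 + k <= z)%N.
  have [m] := ubnP (nat_of_ord z); elim: m z => // m IHm z zm zI.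
  rewrite leqNgt; apply/negP => zk.
  have [|[i zi]|] := @position_cases z; [by rewrite noc ?zL| |by lia].
  have : ((\prod_(j < k | (j <= i)%N) p j)%N %| L`_z)%Z.
    apply: isolated => //; first by rewrite n_def dvdn_mull // dvdn_prod_sub.
    move=> z' z'I ne.
    have zz' : (z < z')%N.
      rewrite ltnNge leq_eqVlt negb_or (inj_eq val_inj) ne /= -leqNgt leqNgt.
      by apply/negP => lt; have := IHm z' _ z'I; lia.
    have [|[i' zi']|half] := @position_cases z'; first by rewrite noc ?zL.
      rewrite zi' nth_middle_terms dvdz_mulr // dvdzE /= dvdn_mull // dvdn_prod_sub // => j /=; lia.
    by rewrite nth_half_terms // dvdzE /= dvdn_mull // dvdn_prod_sub.
  have -> : (\prod_(j < k | (j <= i)%N) p j = p i * \prod_(j < k | (j < i)%N) p j)%N.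
    rewrite (bigD1 i) //=; congr muln; apply: eq_bigl => j.
    by rewrite ltn_neqAle andbC (inj_eq val_inj).
  rewrite zi nth_middle_terms.
  have [pi oddpi] := odd_prime i; have [_ cb] := odd_coprime_b i.
  rewrite dvdzE abszM /= mulnAC dvdn_pmul2r; last first.
    by apply: prodn_cond_gt0 => j _; apply: prime_gt0; case: (odd_prime j).
  rewrite Gauss_dvdr; last by rewrite coprimeXr // coprimen2.
  by move: cb; rewrite coprimezE coprime_sym prime_coprime // => /negPf->.
(* Only the [n - 1] positions of n/2 are left for the [n] elements of [I]. *)
have : (n <= n.-1)%N.
  rewrite -{1}cI cardE -(size_map val) -(size_iota (r.+1 + k) n.-1).
  apply: uniq_leq_size; first by rewrite map_inj_uniq ?enum_uniq //; apply: val_inj.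
  move=> j /mapP[z]; rewrite mem_enum => zI ->; rewrite mem_iota nob //.
  by have := zL z; rewrite size_candidate_terms.
by lia.
Qed.
End Candidate.

(** * Extremality of S from the two bounds *)

Theorem lemma5 (n r k : nat) (p : 'I_k -> nat)
  (hk : (1 <= k)%N)
  (hp : forall i : 'I_k, prime (p i) /\ odd (p i))
  (hn : n = (2 ^ r.+1 * \prod_(i < k) p i)%N)
  (a : 'I_r -> int) (ha : forall i : 'I_r, ~~ (2 %| a i)%Z)
  (c : int) (hc : ((2 ^ r.+1)%N%:Z %| c)%Z)
  (b : 'I_k -> int)
  (hb : forall i : 'I_k, ~~ (2 %| b i)%Z /\ coprimez (b i) (p i)%:Z) :
  ((2 <= k)%N -> gao_extremal (U n) (candidate n a c (middle_terms r p b))) /\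
  (k = 1%N -> gao_extremal (U n) (candidate n a c [:: (2 ^ r)%N%:Z])).
Proof.
have n_gt1 : (1 < n)%N by have := omega_bound hk hp hn; lia.
have main (b' : 'I_k -> int) :
    (forall i, ~~ (2 %| b' i)%Z /\ coprimez (b' i) (p i)%:Z) ->
    gao_extremal (U n) (candidate n a c (middle_terms r p b')).
  move=> hb'; apply: gao_extremal_of; last exact: candidate_zero_sum_free.
  have -> : (size (candidate n a c (middle_terms r p b'))).+1 = (n + (r.+1 + k))%N.
    by rewrite size_map size_candidate_terms; lia.
  exact: units_gao_property.
split=> [_|k1]; first exact: main.
(* For [k = 1] the prescribed middle term is the case [b = 1] of the general form. *)
suff <- : middle_terms r p (fun=> 1) = [:: (2 ^ r)%N%:Z].
  by apply: main => i; rewrite coprimezE coprime1n.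
clear - k1; subst k; rewrite /middle_terms /image_mem enum_ordSl /=.
have -> : enum 'I_0 = [::] by apply/nilP; rewrite /nilp size_enum_ord.
by rewrite big_pred0 ?muln1 ?mulr1.
Qed.
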